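(* Let $R=\mathbb Z$ or $\mathbb F_p$ ($p$ a prime), let $X$ be a set, let $M=M(X,R)$ be the set of all functions $X\to R$, and let $\mu\colon M\times M\to M$ be an arbitrary binary operation. Then the degree-preserving $R$-linear map $\psi=\psi_{X,\mu}\colon\mathsf T_R^{\le2}(X)\to C_\mu(X)$ is a monomorphism that commutes with cup products, cup-one products, and the $\circ$ map.
   Context: Free binomial algebra. $\mathrm{Int}(\mathbb{Z}^X)=\{q\in\mathbb{Q}[X] : q(\mathbb{Z}^X)\subseteq\mathbb{Z}\}$, and $\mathrm{Int}(\mathbb{F}_p^X)$ is the quotient of $\mathrm{Int}(\mathbb{Z}^X)$ by the ideal generated by $\binom{x}{n}$ ($x\in X$, $n\ge p$), tensored with $\mathbb{F}_p$. $\mathfrak{m}_{X,R}\subset \mathrm{Int}(R^X)$ is the submodule of polynomials with zero constant term; $\mathsf{T}_R(X)=T^*(\mathfrak{m}_{X,R})$ is the tensor algebra over $R$, with product $\cup=\otimes$, and maps $a\cup_1 b=ab$ on $\mathsf T^1=\mathfrak m_{X,R}$, $(a\otimes b)\cup_1 c=ac\otimes b+a\otimes bc$ from $\mathsf T^2\otimes\mathsf T^1$ to $\mathsf T^2$, and $(a_1\otimes a_2)\circ(b_1\otimes b_2)=a_1b_1\otimes a_2b_2$ on $\mathsf T^2$. $\mathsf T_R^{\le2}(X)=\mathsf T^0\oplus\mathsf T^1\oplus\mathsf T^2$. The complex $C_\mu(X)$. The magma $(M,\mu)$ determines a 2-dimensional $\Delta$-set $\Delta^{(2)}(M,\mu)$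 with one vertex, one 1-simplex for each $\mathbf a\in M$, and one 2-simplex for each pair $(\mathbf a,\mathbf a')\in M\times M$, with front face $\mathbf a$, back face $\mathbf a'$, and third face $\mu(\mathbf a,\mathbf a')$. $C_\mu(X)$ is its simplicial cochain complex with coefficients in $R$, with cup product $(f\cup g)(\mathbf a,\mathbf a')=f(\mathbf a)g(\mathbf a')$ of 1-cochains, $(f\cup_1g)(\mathbf a)=f(\mathbf a)g(\mathbf a)$ on 1-cochains, $(v\circ w)(s)=v(s)w(s)$ on 2-cochains, and $(f\cup g)\cup_1h=f\cup(g\cup_1h)+(f\cup_1h)\cup g$ for 1-cochains $f,g,h$. The map $\psi$. $\psi$ sends $1\in\mathsf T^0=R$ to the unit 0-cochain; $q\in\mathfrak m_{X,R}$ to the 1-cochain $\mathbf a\mapsto q(\mathbf a)$ (evaluation of the polynomial at the function $\mathbf a\colon X\to R$); and $q\otimes q'\in\mathsf T^2$ to the 2-cochain $(\mathbf a,\mathbf a')\mapsto q(\mathbf a)\,q'(\mathbf a')$. *)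

(* Defs.v *)
From HB Require Import structures.
From mathcomp Require Import all_boot all_order all_algebra.
From mathcomp Require Import finmap boolp functions ring.
From mathcomp.multinomials Require Import monalg.

Set Implicit Arguments.
Unset Strict Implicit.
Unset Printing Implicit Defensive.

Import Order.TTheory GRing.Theory Num.Theory.
Local Open Scope ring_scope.
Local Open Scope quotient_scope.

Section Tensor.
Variables (R : comNzRingType) (U V : lmodType R).

(* The submodule of the free module on U * V generated by the bilinearity
   relations. *)
Inductive bilin_rel : {malg R[(U * V)%type]} -> Prop :=
| bilin_rel_linl c u u' v :
    bilin_rel (<< (c *: u + u', v) >> - c *: << (u, v) >> - << (u', v) >>)
| bilin_rel_linr c u v v' :
    bilin_rel (<< (u, c *: v + v') >> - c *: << (u, v) >> - << (u, v') >>)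
| bilin_rel0 : bilin_rel 0
| bilin_rel_lin c s t : bilin_rel s -> bilin_rel t -> bilin_rel (c *: s + t).

Definition bilin_null : {pred {malg R[(U * V)%type]}} :=
  fun t => `[< bilin_rel t >].

Lemma bilin_null_submod : submod_closed bilin_null.
Proof.
split=> [|c s t /asboolP hs /asboolP ht]; apply/asboolP; first exact: bilin_rel0.
exact: bilin_rel_lin.
Qed.
HB.instance Definition _ :=
  GRing.isSubmodClosed.Build R _ bilin_null bilin_null_submod.

Definition tensor : Type := Quotient.quot bilin_null.
HB.instance Definition _ := GRing.Zmodule.on tensor.
HB.instance Definition _ := ZmodQuotient.on tensor.

Definition tensor_scale (c : R) (t : tensor) : tensor := \pi_tensor (c *: repr t).

Lemma pi_tensor_scale c x : \pi_tensor (c *: x) = tensor_scale c (\pi x).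
Proof.
apply/eqP; rewrite -Quotient.idealrBE -scalerBr rpredZ //.
by rewrite Quotient.idealrBE reprK.
Qed.

Lemma tensor_scaleA a b t :
  tensor_scale a (tensor_scale b t) = tensor_scale (a * b) t.
Proof. by rewrite [tensor_scale b t]/tensor_scale -pi_tensor_scale scalerA. Qed.
Lemma tensor_scale1 : left_id 1 tensor_scale.
Proof. by move=> t; rewrite /tensor_scale scale1r reprK. Qed.
Lemma tensor_scaleDr : right_distributive tensor_scale +%R.
Proof.
move=> a; elim/quotW=> s; elim/quotW=> t.
by rewrite -raddfD -!pi_tensor_scale scalerDr raddfD.
Qed.
Lemma tensor_scaleDl t : {morph tensor_scale^~ t : a b / a + b}.
Proof. by move=> a b; rewrite /tensor_scale scalerDl raddfD. Qed.
HB.instance Definition _ := GRing.Zmodule_isLmodule.Build R tensor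
  tensor_scaleA tensor_scale1 tensor_scaleDr tensor_scaleDl.

Lemma pi_tensorZ c x : \pi_tensor (c *: x) = c *: (\pi_tensor x : tensor).
Proof. exact: pi_tensor_scale. Qed.

End Tensor.

Arguments bilin_null {R} U V _.
Arguments tensor {R} U V.

HB.lock Definition tens (R : comNzRingType) (U V : lmodType R) (u : U) (v : V)
  : tensor U V := \pi_(tensor U V) << (u, v) >>.
Canonical tens_unlockable := Unlockable tens.unlock.

Section TensTheory.
Variables (R : comNzRingType) (U V : lmodType R).
Notation tensor := (tensor U V).
Notation tens := (@tens R U V).

Lemma tens_linl c u u' v : tens (c *: u + u') v = c *: tens u v + tens u' v.
Proof.
rewrite tens.unlock -pi_tensorZ -raddfD /=.
apply/eqP; rewrite -Quotient.idealrBE opprD addrA.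
by apply/asboolP; exact: bilin_rel_linl.
Qed.

Lemma tens_linr c u v v' : tens u (c *: v + v') = c *: tens u v + tens u v'.
Proof.
rewrite tens.unlock -pi_tensorZ -raddfD /=.
apply/eqP; rewrite -Quotient.idealrBE opprD addrA.
by apply/asboolP; exact: bilin_rel_linr.
Qed.

Lemma tens0l v : tens 0 v = 0.
Proof.
by have := tens_linl (-1) 0 0 v; rewrite scaler0 addr0 scaleN1r addNr.
Qed.

Lemma tens0r u : tens u 0 = 0.
Proof.
by have := tens_linr (-1) u 0 0; rewrite scaler0 addr0 scaleN1r addNr.
Qed.

Lemma tensZl c u v : tens (c *: u) v = c *: tens u v.
Proof. by have := tens_linl c u 0 v; rewrite tens0l !addr0. Qed.

Lemma tensZr c u v : tens u (c *: v) = c *: tens u v.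
Proof. by have := tens_linr c u v 0; rewrite tens0r !addr0. Qed.

Lemma tensDl u u' v : tens (u + u') v = tens u v + tens u' v.
Proof. by have := tens_linl 1 u u' v; rewrite !scale1r. Qed.

Lemma tensDr u v v' : tens u (v + v') = tens u v + tens u v'.
Proof. by have := tens_linr 1 u v v'; rewrite !scale1r. Qed.

Lemma tensor_ind (P : tensor -> Prop) :
  (forall c u v t, P t -> P (c *: tens u v + t)) -> P 0 -> forall t, P t.
Proof.
move=> PD P0 t; rewrite -[t]reprK [repr t]monalgE.
elim: (enum_fset _) => [|[u v] s IH]; first by rewrite big_nil raddf0.
rewrite big_cons raddfD /=.
have -> : \pi_tensor << (repr t)@_(u, v) *g (u, v) >>
          = (repr t)@_(u, v) *: tens u v.
  rewrite tens.unlock -pi_tensorZ; congr (\pi _).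
  by apply/malgP=> k; rewrite !mcoeffsE /= mulr_natr.
exact: PD.
Qed.

End TensTheory.

Definition bilin (R : comNzRingType) (U V W : lmodType R) (f : U -> V -> W) :=
  (forall v, linear (f^~ v)) /\ (forall u, linear (f u)).

(* The linear map out of the tensor product induced by f; this is meaningful
   when f is bilinear, see tensor_liftE and tensor_lift_linear. *)
HB.lock Definition tensor_lift (R : comNzRingType) (U V W : lmodType R)
    (f : U -> V -> W) (t : tensor U V) : W :=
  \sum_(k <- msupp (repr t)) (repr t)@_k *: f k.1 k.2.
Canonical tensor_lift_unlockable := Unlockable tensor_lift.unlock.

Section TensorLift.
Variables (R : comNzRingType) (U V W : lmodType R).

Let pre (f : U -> V -> W) (t : {malg R[(U * V)%type]}) : W :=
  \sum_(k <- msupp t) t@_k *: f k.1 k.2.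

Let preEw f (d : {fset (U * V)%type}) t : (msupp t `<=` d)%fset ->
  pre f t = \sum_(k <- d) t@_k *: f k.1 k.2.
Proof.
move=> le; rewrite [LHS](big_fset_incl _ le) => //= x xd /mcoeff_outdom ->.
by rewrite scale0r.
Qed.

Let preU f (k : (U * V)%type) : pre f << k >> = f k.1 k.2.
Proof. by rewrite (preEw _ (msuppU_le)) big_seq_fset1 mcoeffUU scale1r. Qed.

Let pre_lin f : linear (pre f).
Proof.
move=> c s t.
pose d := (msupp (c *: s + t) `|` msupp s `|` msupp t)%fset.
rewrite !(@preEw _ d) ?scaler_sumr -?big_split /=.
- by apply: eq_bigr => k _; rewrite !mcoeffsE scalerDl scalerA.
- by rewrite /d fsubsetUr.
- by rewrite /d -fsetUA fsetUCA fsubsetUl.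
- by rewrite /d -fsetUA fsubsetUl.
Qed.

Let pre_null f t : bilin f -> bilin_rel t -> pre f t = 0.
Proof.
case=> fl fr; pose F : {linear _ -> _} := HB.pack (pre f)
  (GRing.isLinear.Build _ _ _ _ (pre f) (pre_lin f)).
rewrite -[pre f]/(F : _ -> _).
elim=> [c u u' v|c u v v'||c s t' _ hs _ ht].
- by rewrite !linearB linearZ /= !preU /= fl -addrA -opprD subrr.
- by rewrite !linearB linearZ /= !preU /= fr -addrA -opprD subrr.
- exact: linear0.
- by rewrite linearP hs ht scaler0 addr0.
Qed.

Let tensor_lift_pi f t : bilin f -> tensor_lift f (\pi t) = pre f t.
Proof.
move=> bf; pose F : {linear _ -> _} := HB.pack (pre f)
  (GRing.isLinear.Build _ _ _ _ (pre f) (pre_lin f)).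
rewrite tensor_lift.unlock; apply/eqP; rewrite -subr_eq0 -[\sum_(k <- _) _]/(F _) -[pre f t]/(F _) -linearB.
apply/eqP/(pre_null bf).
suff: repr (\pi_(tensor U V) t) - t \in bilin_null U V by move/asboolP.
by rewrite Quotient.idealrBE reprK.
Qed.

Lemma tensor_liftE (f : U -> V -> W) u v : bilin f -> tensor_lift f (tens u v) = f u v.
Proof. by move=> bf; rewrite tens.unlock tensor_lift_pi // preU. Qed.

Lemma tensor_lift_linear (f : U -> V -> W) : bilin f -> linear (tensor_lift f).
Proof.
move=> bf c s t; rewrite -[s]reprK -[t]reprK.
rewrite -pi_tensorZ -raddfD /=.
by rewrite !tensor_lift_pi // pre_lin.
Qed.

Lemma tensor_lift0 (f : U -> V -> W) : bilin f -> tensor_lift f 0 = 0.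
Proof.
move=> bf; have := tensor_lift_linear bf (-1) 0 0.
by rewrite scaleN1r oppr0 addr0 scaleN1r addNr.
Qed.

End TensorLift.

Section TensorMap2.
Variables (R : comNzRingType) (U1 U2 U3 V1 V2 V3 : lmodType R).
Variables (f : U1 -> U2 -> U3) (g : V1 -> V2 -> V3).

(* (u1 (x) v1, u2 (x) v2) |-> f u1 u2 (x) g v1 v2 *)
Definition tensor_map2 (s : tensor U1 V1) (t : tensor U2 V2) : tensor U3 V3 :=
  tensor_lift (fun u1 v1 =>
    tensor_lift (fun u2 v2 => tens (f u1 u2) (g v1 v2)) t) s.

Hypotheses (bf : bilin f) (bg : bilin g).

Let inner_bilin u1 v1 : bilin (fun u2 v2 => tens (f u1 u2) (g v1 v2)).
Proof.
case: bf bg => _ fr [_ gr].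
by split=> [v|u] c x y; rewrite ?fr ?gr (tens_linl, tens_linr).
Qed.

Let outer_bilin t :
  bilin (fun u1 v1 => tensor_lift (fun u2 v2 => tens (f u1 u2) (g v1 v2)) t).
Proof.
case: bf bg => fl _ [gl _].
split=> [v|u] c x y; move: t; apply: tensor_ind => [a u2 v2 t IH|].
- rewrite !tensor_lift_linear // IH !tensor_liftE // fl tens_linl.
  by rewrite !scalerDr !scalerA [a * c]mulrC addrACA.
- by rewrite !tensor_lift0 // scaler0 addr0.
- rewrite !tensor_lift_linear // IH !tensor_liftE // gl tens_linr.
  by rewrite !scalerDr !scalerA [a * c]mulrC addrACA.
- by rewrite !tensor_lift0 // scaler0 addr0.
Qed.

Lemma tensor_map2E u1 v1 u2 v2 :
  tensor_map2 (tens u1 v1) (tens u2 v2) = tens (f u1 u2) (g v1 v2).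
Proof. by rewrite /tensor_map2 !tensor_liftE. Qed.

Lemma tensor_map2_bilin : bilin tensor_map2.
Proof.
split=> [t|s]; first exact: tensor_lift_linear.
move=> c x y; move: s; apply: tensor_ind => [a u v s IH|].
  rewrite /tensor_map2 in IH *.
  rewrite !tensor_lift_linear // IH !tensor_liftE // tensor_lift_linear //.
  by rewrite !scalerDr !scalerA [a * c]mulrC addrACA.
by rewrite /tensor_map2 !tensor_lift0 // scaler0 addr0.
Qed.

End TensorMap2.

Section IntZ.
Variable X : choiceType.

Notation QX := {malg rat[{cmonom X}]}.

Definition monom_eval (a : X -> rat) (m : {cmonom X}) : rat :=
  \prod_(x <- finsupp m) a x ^+ m x.

Lemma monom_eval_mmorphism a : mmorphism (monom_eval a).
Proof.
have Ew (m : {cmonom X}) (d : {fset X}) : (finsupp m `<=` d)%fset ->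
    monom_eval a m = \prod_(x <- d) a x ^+ m x.
  move=> le; rewrite /monom_eval (big_fset_incl _ le) // => x _.
  by rewrite -cmE_eq0 => /eqP ->.
split=> [m1 m2|]; last by rewrite /monom_eval mdom1 big_seq_fset0.
rewrite (Ew m1 _ (fsubsetUl _ (finsupp m2))) (Ew m2 _ (fsubsetUr (finsupp m1) _)).
rewrite /monom_eval mdomD -big_split; apply: eq_bigr => x _.
by rewrite cmM exprD.
Qed.
HB.instance Definition _ a :=
  isMultiplicative.Build _ _ (monom_eval a) (monom_eval_mmorphism a).

Definition peval (a : X -> rat) (q : QX) : rat := mmap idfun (monom_eval a) q.
HB.instance Definition _ a := GRing.RMorphism.copy (peval a)
  (mmap (idfun : {rmorphism rat -> rat}) (monom_eval a : {mmorphism _ -> _})).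

Definition int_valued : {pred QX} := fun q =>
  `[< forall a : X -> int, peval (fun x => (a x)%:~R) q \is a Num.int >].

Lemma int_valued_subring : subring_closed int_valued.
Proof.
split=> [|p q /asboolP hp /asboolP hq|p q /asboolP hp /asboolP hq];
  apply/asboolP => a.
- by rewrite rmorph1 rpred1.
- by rewrite rmorphB rpredB ?hp ?hq.
- by rewrite rmorphM rpredM ?hp ?hq.
Qed.
HB.instance Definition _ :=
  GRing.isSubringClosed.Build QX int_valued int_valued_subring.

Record IntZ : predArgType := MkIntZ { IntZ_val : QX; _ : IntZ_val \in int_valued }.
HB.instance Definition _ := [isSub for IntZ_val].
HB.instance Definition _ := [Choice of IntZ by <:].
HB.instance Definition _ := [SubChoice_isSubComNzRing of IntZ by <:].

HB.instance Definition _ := GRing.Lmodule.copy IntZ (zmodule IntZ).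
Lemma IntZ_scalerAl (n : int) (x y : IntZ) : n *: (x * y) = n *: x * y.
Proof. by rewrite -[LHS]mulrzAl. Qed.
Lemma IntZ_scalerAr (n : int) (x y : IntZ) : n *: (x * y) = x * (n *: y).
Proof. by rewrite -[LHS]mulrzAr. Qed.
HB.instance Definition _ := GRing.Lmodule_isLalgebra.Build int IntZ IntZ_scalerAl.
HB.instance Definition _ := GRing.Lalgebra_isAlgebra.Build int IntZ IntZ_scalerAr.

Definition evZ (a : X -> int) (q : IntZ) : int :=
  Num.floor (peval (fun x => (a x)%:~R) (val q)).

Lemma evZE a q : (evZ a q)%:~R = peval (fun x => (a x)%:~R) (val q).
Proof. by apply/floorK; case: q => q /= /asboolP. Qed.

Lemma evZ_zmod a : zmod_morphism (evZ a).
Proof.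
by move=> p q; apply: (@intr_inj rat); rewrite rmorphB /= !evZE !rmorphB.
Qed.
HB.instance Definition _ a := GRing.isZmodMorphism.Build _ _ (evZ a) (evZ_zmod a).
Lemma evZ_monoid a : monoid_morphism (evZ a).
Proof.
split=> [|p q]; apply: (@intr_inj rat); first by rewrite evZE !rmorph1.
by rewrite rmorphM /= !evZE !rmorphM.
Qed.
HB.instance Definition _ a :=
  GRing.isMonoidMorphism.Build _ _ (evZ a) (evZ_monoid a).

(* The polynomial x (x - 1) ... (x - n + 1) / n! *)
Definition binomX (x : X) (n : nat) : QX :=
  (n`!%:R)^-1 *: \prod_(i < n) (<< ucm x >> - i%:R).

Lemma peval_binomX a x n :
  peval a (binomX x n) = (n`!%:R)^-1 * \prod_(i < n) (a x - i%:R).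
Proof.
rewrite /binomX -mul_malgC rmorphM rmorph_prod /=.
rewrite {1}/peval mmapC; congr (_ * _).
apply: eq_bigr => i _; rewrite rmorphB rmorph_nat; congr (_ - _).
by rewrite /= /peval mmapU mul1r /monom_eval mdomU big_seq_fset1 cmUU expr1.
Qed.

Lemma binomX_int_valued x n : binomX x n \in int_valued.
Proof.
have natcase (m : nat) :
    (n`!%:R)^-1 * \prod_(i < n) (m%:R - i%:R) = 'C(m, n)%:R :> rat.
  have -> : \prod_(i < n) (m%:R - i%:R) = (m ^_ n)%:R :> rat.
    have [lnm|lmn] := leqP n m.
      rewrite ffact_prod natr_prod; apply: eq_bigr => i _.
      by rewrite natrB // (leq_trans (ltnW (ltn_ord i))).
    by rewrite ffact_small // (bigD1 (Ordinal lmn)) //= subrr mul0r.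
  by rewrite -bin_ffact natrM mulrCA mulVf ?mulr1 // pnatr_eq0 -lt0n fact_gt0.
apply/asboolP => a; rewrite peval_binomX.
case: (a x) => m; first by rewrite natcase rpred_nat.
have -> : \prod_(i < n) ((Negz m)%:~R - i%:R)
    = (-1) ^+ n * \prod_(i < n) ((m + n)%:R - i%:R) :> rat.
  rewrite [in RHS](reindex_inj rev_ord_inj) /= -[X in (-1) ^+ X]card_ord.
  rewrite -prodr_const -big_split /=; apply: eq_bigr => i _.
  have -> : (n - i.+1)%:R = n%:R - i%:R - 1 :> rat by rewrite natrB // -natr1 opprD addrA.
  by rewrite NegzE mulrNz -pmulrn -natr1 natrD; ring.
by rewrite mulrCA natcase rpredM ?rpredX ?rpredN ?rpred1 ?rpred_nat.
Qed.

Definition binomZ x n : IntZ := MkIntZ (binomX_int_valued x n).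

Definition const_term (q : IntZ) : rat := (val q)@_(mone : {cmonom X}).

End IntZ.

Record primeT := PrimeT { prime_val :> nat; prime_valP : prime prime_val }.

Section IntFp.
Variables (X : choiceType) (p : primeT).

(* The ideal of Int(Z^X) generated by the binomials (x choose n), n >= p. *)
Definition binom_ideal : {pred IntZ X} := fun q =>
  `[< exists2 s : seq (IntZ X * X * nat), all (fun t => (p <= t.2)%N) s &
      q = \sum_(t <- s) t.1.1 * binomZ t.1.2 t.2 >].

Definition lift_Fp (a : X -> 'F_p) : X -> int := fun x => (nat_of_ord (a x))%:Z.

Lemma evZ_binomZ_small (a : X -> int) x n (m : nat) :
  a x = m%:Z -> (m < n)%N -> evZ a (binomZ x n) = 0.
Proof.
move=> ax lmn; apply: (@intr_inj rat); rewrite evZE peval_binomX ax.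
by rewrite (bigD1 (Ordinal lmn)) //= subrr mul0r mulr0.
Qed.

Lemma binom_ideal_ev (a : X -> int) q :
  (forall x, exists2 m : nat, a x = m%:Z & (m < p)%N) ->
  q \in binom_ideal -> evZ a q = 0.
Proof.
move=> ha /asboolP[s /allP hs ->]; rewrite rmorph_sum big_seq big1 //= => t ts.
have [m am mp] := ha t.1.2.
by rewrite rmorphM /= (evZ_binomZ_small am) ?mulr0 // (leq_trans mp) ?hs.
Qed.

Lemma lift_Fp_small (a : X -> 'F_p) x : (nat_of_ord (a x) < p)%N.
Proof.
rewrite (leq_trans (ltn_ord _)) // -[in leqRHS](pdiv_id (prime_valP p)).
by rewrite Zp_cast ?pdiv_id ?prime_gt1 ?prime_valP.
Qed.

Lemma binom_ideal_closed : idealr_closed binom_ideal.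
Proof.
split=> [|| c u v /asboolP[s hs ->] /asboolP[t ht ->]].
- by apply/asboolP; exists [::]; rewrite // big_nil.
- apply/negP => /(@binom_ideal_ev (fun=> 0)) h.
  have: evZ (fun=> 0) (1 : IntZ X) = 0.
    by apply: h => x; exists 0%N; rewrite // prime_gt0 ?prime_valP.
  by rewrite rmorph1.
- apply/asboolP; exists ([seq (c * x.1.1, x.1.2, x.2) | x <- s] ++ t).
    by rewrite all_cat all_map ht andbT.
  rewrite big_cat big_map /= mulr_sumr; congr (_ + _).
  by apply: eq_bigr => x _; rewrite mulrA.
Qed.
HB.instance Definition _ := isIdealr.Build _ binom_ideal binom_ideal_closed.

Definition IntZmod : Type := Quotient.quot binom_ideal.
HB.instance Definition _ := GRing.ComNzRing.on IntZmod.
HB.instance Definition _ := NzRingQuotient.on IntZmod.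

(* Int(F_p^X) = (Int(Z^X) / binom_ideal) (x)_Z F_p *)
Definition IntFp : Type := tensor (zmodule IntZmod) (zmodule 'F_p).
HB.instance Definition _ := GRing.Zmodule.on IntFp.

Definition IntFp_tens (b : IntZmod) (s : 'F_p) : IntFp :=
  @tens _ (zmodule IntZmod) (zmodule 'F_p) b s.

Let zmul_bilin (A : comNzRingType) :
  @bilin _ (zmodule A) (zmodule A) (zmodule A) ( *%R : A -> A -> A).
Proof.
split=> [y|x] c u v; rewrite ?scalezrE /=.
  by rewrite (mulrDl (u *~ c : A)) mulrzAl.
by rewrite (mulrDr x (u *~ c : A)) mulrzAr.
Qed.

Definition IntFp_mul : IntFp -> IntFp -> IntFp :=
  @tensor_map2 _ (zmodule IntZmod) (zmodule IntZmod) (zmodule IntZmod)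
    (zmodule 'F_p) (zmodule 'F_p) (zmodule 'F_p)
    ( *%R : IntZmod -> _) ( *%R : 'F_p -> _).

Let mul_bilin : @bilin _ (tensor (zmodule IntZmod) (zmodule 'F_p))
  (tensor (zmodule IntZmod) (zmodule 'F_p))
  (tensor (zmodule IntZmod) (zmodule 'F_p)) IntFp_mul.
Proof. exact: tensor_map2_bilin (zmul_bilin _) (zmul_bilin _). Qed.

Lemma IntFp_mulE b s b' s' :
  IntFp_mul (IntFp_tens b s) (IntFp_tens b' s') = IntFp_tens (b * b') (s * s').
Proof. exact: tensor_map2E (zmul_bilin _) (zmul_bilin _) _ _ _ _. Qed.

Lemma IntFp_ind (P : IntFp -> Prop) :
  (forall b s t, P t -> P (IntFp_tens b s + t)) -> P 0 -> forall t, P t.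
Proof.
move=> PD P0; apply: tensor_ind => // c b s t Pt.
by rewrite -tensZl; exact: PD.
Qed.

Lemma IntFp_tensDl b b' s :
  IntFp_tens (b + b') s = IntFp_tens b s + IntFp_tens b' s.
Proof. exact: tensDl. Qed.
Lemma IntFp_tensDr b s s' :
  IntFp_tens b (s + s') = IntFp_tens b s + IntFp_tens b s'.
Proof. exact: tensDr. Qed.

Lemma IntFp_tens0l s : IntFp_tens 0 s = 0.
Proof. exact: tens0l. Qed.
Lemma IntFp_tens0r b : IntFp_tens b 0 = 0.
Proof. exact: tens0r. Qed.

Let mulDl (x y z : IntFp) :
  IntFp_mul (x + y) z = IntFp_mul x z + IntFp_mul y z.
Proof.
by have := mul_bilin.1 z 1 x y; rewrite !scale1r.
Qed.
Let mulDr (x y z : IntFp) :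
  IntFp_mul x (y + z) = IntFp_mul x y + IntFp_mul x z.
Proof. by have := mul_bilin.2 x 1 y z; rewrite !scale1r. Qed.
Let imul0l (x : IntFp) : IntFp_mul 0 x = 0.
Proof.
by have := mulDl 0 0 x; rewrite addr0 => /eqP; rewrite addrC -subr_eq subrr => /eqP.
Qed.
Let imul0r (x : IntFp) : IntFp_mul x 0 = 0.
Proof.
by have := mulDr x 0 0; rewrite addr0 => /eqP; rewrite addrC -subr_eq subrr => /eqP.
Qed.

Let addr_congr (x x' y : IntFp) : x = x' -> x + y = x' + y.
Proof. by move->. Qed.

Lemma IntFp_mulA : associative IntFp_mul.
Proof.
move=> x y z; elim/IntFp_ind: x => [b s x IH|]; last by rewrite !imul0l.
rewrite !mulDl IH; apply: addr_congr; elim/IntFp_ind: y {IH} => [c r y IH|]; last first.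
  by rewrite imul0l !imul0r imul0l.
rewrite mulDl !mulDr mulDl IH; apply: addr_congr.
elim/IntFp_ind: z {IH} => [d u z IH|]; last by rewrite !imul0r.
by rewrite !mulDr IH !IntFp_mulE !mulrA.
Qed.

Lemma IntFp_mulC : commutative IntFp_mul.
Proof.
move=> x y; elim/IntFp_ind: x => [b s x IH|]; last by rewrite imul0l imul0r.
rewrite mulDl mulDr IH; apply: addr_congr.
elim/IntFp_ind: y {IH} => [c r y IH|]; last by rewrite imul0l imul0r.
by rewrite mulDl mulDr IH !IntFp_mulE mulrC [s * r]mulrC.
Qed.

Lemma IntFp_mul1 : left_id (IntFp_tens 1 1) IntFp_mul.
Proof.
elim/IntFp_ind => [b s x IH|]; last by rewrite imul0r.
by rewrite mulDr IH IntFp_mulE !mul1r.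
Qed.

Definition evIntZmod (a : X -> 'F_p) (b : IntZmod) : 'F_p :=
  (evZ (lift_Fp a) (repr b))%:~R.

Lemma evIntZmod_pi a (q : IntZ X) :
  evIntZmod a (\pi_IntZmod q) = (evZ (lift_Fp a) q)%:~R.
Proof.
apply/eqP; rewrite -subr_eq0 -rmorphB -rmorphB /= binom_ideal_ev ?mulr0z //.
  by move=> x; exists (a x); rewrite // lift_Fp_small.
by rewrite Quotient.idealrBE reprK.
Qed.

Lemma evIntZmodD a b c : evIntZmod a (b + c) = evIntZmod a b + evIntZmod a c.
Proof.
elim/quotW: b => b; elim/quotW: c => c.
by rewrite -rmorphD !evIntZmod_pi !rmorphD.
Qed.
Lemma evIntZmodM a b c : evIntZmod a (b * c) = evIntZmod a b * evIntZmod a c.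
Proof.
elim/quotW: b => b; elim/quotW: c => c.
by rewrite -rmorphM !evIntZmod_pi !rmorphM.
Qed.
Lemma evIntZmod1 a : evIntZmod a 1 = 1.
Proof. by rewrite -(rmorph1 (\pi_IntZmod)) evIntZmod_pi !rmorph1. Qed.
Let evIntZmodMz a b c : evIntZmod a (b *~ c) = evIntZmod a b *~ c.
Proof.
by elim/quotW: b => b; rewrite -rmorphMz !evIntZmod_pi !rmorphMz.
Qed.

(* Evaluation at a : X -> F_p; it is the F_p-algebra morphism sending x to a x,
   see evFp_X.  The binomials (x choose n), n >= p, vanish at the lift of a to
   {0, ..., p - 1}, so evIntZmod does not depend on the representative. *)
Definition evFp (a : X -> 'F_p) (t : IntFp) : 'F_p :=
  @tensor_lift _ (zmodule IntZmod) (zmodule 'F_p) (zmodule 'F_p)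
    (fun b s => evIntZmod a b * s) t.

Let evFp_bilin a : @bilin _ (zmodule IntZmod) (zmodule 'F_p) (zmodule 'F_p)
  (fun b s => evIntZmod a b * s).
Proof.
split=> [s|b] c x y; rewrite ?scalezrE /=.
  by rewrite evIntZmodD evIntZmodMz (mulrDl (_ *~ c)) mulrzAl.
by rewrite (mulrDr _ (_ *~ c : 'F_p)) mulrzAr.
Qed.

Lemma evFp_tens a b s : evFp a (IntFp_tens b s) = evIntZmod a b * s.
Proof. exact: tensor_liftE (evFp_bilin a). Qed.

Lemma evFpD a x y : evFp a (x + y) = evFp a x + evFp a y.
Proof.
by have := tensor_lift_linear (evFp_bilin a) 1 x y; rewrite !scale1r.
Qed.

Lemma evFp0 a : evFp a 0 = 0.
Proof. exact: tensor_lift0 (evFp_bilin a). Qed.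

Lemma IntFp_nonzero1 : IntFp_tens 1 1 != 0.
Proof.
apply/eqP => /(congr1 (evFp (fun=> 0))); rewrite evFp_tens evIntZmod1 evFp0 mulr1.
by move/eqP; rewrite oner_eq0.
Qed.

HB.instance Definition _ := GRing.Zmodule_isComNzRing.Build IntFp
  IntFp_mulA IntFp_mulC IntFp_mul1 mulDl IntFp_nonzero1.

(* Extension of scalars: c *: (b (x) s) = b (x) (c * s). *)
Definition IntFp_scale (c : 'F_p) (t : IntFp) : IntFp :=
  @tensor_lift _ (zmodule IntZmod) (zmodule 'F_p)
    (tensor (zmodule IntZmod) (zmodule 'F_p))
    (fun b s => IntFp_tens b (c * s)) t.

Lemma IntFp_scaleE c t : IntFp_scale c t = IntFp_tens 1 c * t.
Proof.
have bl : @bilin _ (zmodule IntZmod) (zmodule 'F_p)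
    (tensor (zmodule IntZmod) (zmodule 'F_p)) (fun b s => IntFp_tens b (c * s)).
  split=> [s|b] d x y; first exact: tens_linl.
  by rewrite /IntFp_tens ((zmul_bilin _).2 c) tens_linr.
elim/IntFp_ind: t => [b s t IH|]; last by rewrite mulr0; exact: tensor_lift0 bl.
rewrite mulrDr -IH -[_ * _]/(IntFp_mul _ _) IntFp_mulE mul1r.
have -> : IntFp_scale c (IntFp_tens b s + t)
    = IntFp_scale c (IntFp_tens b s) + IntFp_scale c t.
  by have := tensor_lift_linear bl 1 (IntFp_tens b s) t; rewrite !scale1r.
by apply: addr_congr; exact: tensor_liftE bl.
Qed.

Lemma IntFp_scaleA a b t :
  IntFp_scale a (IntFp_scale b t) = IntFp_scale (a * b) t.
Proof.
by rewrite !IntFp_scaleE mulrA -[X in X * t]/(IntFp_mul _ _) IntFp_mulE mulr1.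
Qed.
Lemma IntFp_scale1 : left_id 1 IntFp_scale.
Proof. by move=> t; rewrite IntFp_scaleE mul1r. Qed.
Lemma IntFp_scaleDr : right_distributive IntFp_scale +%R.
Proof. by move=> a s t; rewrite !IntFp_scaleE mulrDr. Qed.
Lemma IntFp_scaleDl t : {morph IntFp_scale^~ t : a b / a + b}.
Proof. by move=> a b; rewrite !IntFp_scaleE IntFp_tensDr mulrDl. Qed.
HB.instance Definition _ := GRing.Zmodule_isLmodule.Build 'F_p IntFp
  IntFp_scaleA IntFp_scale1 IntFp_scaleDr IntFp_scaleDl.

Lemma IntFp_scalerAl (c : 'F_p) (x y : IntFp) : c *: (x * y) = c *: x * y.
Proof. by rewrite /GRing.scale /= !IntFp_scaleE mulrA. Qed.
Lemma IntFp_scalerAr (c : 'F_p) (x y : IntFp) : c *: (x * y) = x * (c *: y).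
Proof. by rewrite /GRing.scale /= !IntFp_scaleE mulrCA. Qed.
HB.instance Definition _ :=
  GRing.Lmodule_isLalgebra.Build 'F_p IntFp IntFp_scalerAl.
HB.instance Definition _ :=
  GRing.Lalgebra_isAlgebra.Build 'F_p IntFp IntFp_scalerAr.

Lemma evFpM a x y : evFp a (x * y) = evFp a x * evFp a y.
Proof.
elim/IntFp_ind: x => [b s x IH|]; last by rewrite mul0r !evFp0 mul0r.
rewrite mulrDl !evFpD mulrDl IH; congr (_ + _).
elim/IntFp_ind: y {IH} => [c r y IH|]; last by rewrite mulr0 !evFp0 mulr0.
rewrite mulrDr !evFpD mulrDr IH; congr (_ + _).
by rewrite -[X in evFp a X]/(IntFp_mul _ _) IntFp_mulE !evFp_tens evIntZmodM mulrACA.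
Qed.

Lemma evFpZ a c x : evFp a (c *: x) = c * evFp a x.
Proof.
by rewrite /GRing.scale /= IntFp_scaleE evFpM evFp_tens evIntZmod1 mul1r.
Qed.

(* The image of a polynomial in Int(Z^X). *)
Definition redFp (q : IntZ X) : IntFp := IntFp_tens (\pi_IntZmod q) 1.

Lemma redFp_zmod : zmod_morphism redFp.
Proof.
move=> q q'; apply/eqP; rewrite eq_sym subr_eq; apply/eqP.
by rewrite -IntFp_tensDl -rmorphD subrK.
Qed.
HB.instance Definition _ := GRing.isZmodMorphism.Build _ _ redFp redFp_zmod.
Lemma redFp_monoid : monoid_morphism redFp.
Proof.
split=> [|q q']; first by rewrite /redFp rmorph1.
by rewrite -[RHS]/(IntFp_mul _ _) IntFp_mulE mulr1 -rmorphM.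
Qed.
HB.instance Definition _ := GRing.isMonoidMorphism.Build _ _ redFp redFp_monoid.

Lemma evFp_red a q : evFp a (redFp q) = (evZ (lift_Fp a) q)%:~R.
Proof. by rewrite evFp_tens evIntZmod_pi mulr1. Qed.

Lemma evFp_X a x : evFp a (redFp (binomZ x 1)) = a x.
Proof.
rewrite evFp_red; have -> : evZ (lift_Fp a) (binomZ x 1) = lift_Fp a x.
  apply: (@intr_inj rat); rewrite evZE peval_binomX.
  by rewrite big_ord_recl big_ord0 subr0 factS fact0 invr1 mul1r mulr1.
by rewrite /lift_Fp -pmulrn natr_Zp.
Qed.

Lemma scale_redFp (c : 'F_p) q :
  c *: redFp q = redFp (q *+ nat_of_ord c).
Proof.
rewrite {1}/GRing.scale /= IntFp_scaleE /redFp.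
rewrite -[LHS]/(IntFp_mul _ _) IntFp_mulE mul1r mulr1 -{1}[c]natr_Zp.
elim: (nat_of_ord c) => [|n IH].
  rewrite !mulr0n raddf0.
  by rewrite IntFp_tens0l IntFp_tens0r.
by rewrite -natr1 IntFp_tensDr IH mulrS raddfD IntFp_tensDl addrC.
Qed.

(* The classes of the polynomials with zero constant term. *)
Definition IntFp_const0 : {pred IntFp} := fun t =>
  `[< exists2 q : IntZ X, const_term q = 0 & t = redFp q >].

Lemma IntFp_const0_submod : submod_closed IntFp_const0.
Proof.
split=> [|c s t /asboolP[q q0 ->] /asboolP[r r0 ->]]; apply/asboolP.
  by exists 0; rewrite ?raddf0 // /const_term raddf0.
exists (q *+ nat_of_ord c + r); last by rewrite scale_redFp raddfD.
by rewrite /const_term !raddfD !raddfMn /= -!/(const_term _) q0 r0 mul0rn addr0.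
Qed.

Lemma IntFp_const0M : {in IntFp_const0 &, forall s t, s * t \in IntFp_const0}.
Proof.
move=> s t /asboolP[q q0 ->] /asboolP[r r0 ->]; apply/asboolP.
exists (q * r); last by rewrite rmorphM.
by rewrite /const_term !rmorphM /= -!/(const_term _) q0 mul0r.
Qed.

Lemma evFp_linear a : linear (evFp a : IntFp -> ('F_p)^o).
Proof. by move=> c s t; rewrite evFpD evFpZ. Qed.

End IntFp.

Definition IntZ_const0 (X : choiceType) : {pred IntZ X} :=
  fun q => const_term q == 0.

Lemma IntZ_const0_submod X : submod_closed (@IntZ_const0 X).
Proof.
split=> [|c s t /eqP s0 /eqP t0]; apply/eqP; first by rewrite /const_term raddf0.
rewrite /const_term !raddfD /= -!/(const_term _) t0 addr0.
by rewrite /const_term !raddfMz /= -!/(const_term _) s0 mul0rz.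
Qed.

Lemma IntZ_const0M X :
  {in @IntZ_const0 X &, forall s t, s * t \in @IntZ_const0 X}.
Proof.
move=> q r /eqP q0 _; apply/eqP.
by rewrite /const_term !rmorphM /= -!/(const_term _) q0 mul0r.
Qed.

Lemma evZ_linear X a : linear (@evZ X a : IntZ X -> int^o).
Proof.
by move=> c s t; rewrite raddfD /= raddfMz /= -mulrzl intz.
Qed.

(* The data attached to (R, X): the algebra Int(R^X), its evaluation maps, and
   the polynomials with zero constant term. *)
Record binom_alg (R : comNzRingType) (X : choiceType) := BinomAlg {
  Int_alg :> comAlgType R;
  evalI : (X -> R) -> Int_alg -> R;
  const0 : {pred Int_alg};
  evalI_linear : forall a, linear (evalI a : Int_alg -> R^o);
  evalIM : forall a, {morph evalI a : q r / q * r};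
  const0_submod : submod_closed const0;
  const0M : {in const0 &, forall q r, q * r \in const0}
}.

Arguments const0 {R X} b _.

Inductive coef := CoefZ | CoefF of primeT.

Definition coef_ring (k : coef) : comNzRingType :=
  match k with CoefZ => int | CoefF p => 'F_p end.

Definition IntR (k : coef) (X : choiceType) : binom_alg (coef_ring k) X :=
  match k with
  | CoefZ => @BinomAlg int X (IntZ X) (@evZ X) (@IntZ_const0 X)
      (@evZ_linear X) (fun a => rmorphM (evZ a))
      (@IntZ_const0_submod X) (@IntZ_const0M X)
  | CoefF p => @BinomAlg 'F_p X (IntFp X p) (@evFp X p) (@IntFp_const0 X p)
      (@evFp_linear X p) (@evFpM X p)
      (@IntFp_const0_submod X p) (@IntFp_const0M X p)
  end.

HB.instance Definition _ R X (A : binom_alg R X) :=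
  GRing.isSubmodClosed.Build R A (const0 A) (const0_submod A).

Section TruncatedTensorAlgebra.
Variables (R : comNzRingType) (X : choiceType) (A : binom_alg R X).

(* The module m_{X,R}. *)
Record mX : predArgType := MX { mX_val : A; _ : mX_val \in const0 A }.
HB.instance Definition _ := [isSub for mX_val].
HB.instance Definition _ := [Choice of mX by <:].
HB.instance Definition _ := [SubChoice_isSubLmodule of mX by <:].

Definition T2 : lmodType R := tensor mX mX.

Definition Tle2 : lmodType R := (R^o * mX * T2)%type.

(* The product of the tensor algebra modulo tensors of degree > 2. *)
Definition Tcup (u v : Tle2) : Tle2 :=
  (u.1.1 * v.1.1,
   u.1.1 *: v.1.2 + v.1.1 *: u.1.2,
   u.1.1 *: v.2 + tens u.1.2 v.1.2 + v.1.1 *: u.2).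

Definition Tcup1_11 (q r : mX) : mX :=
  MX (const0M (valP q) (valP r)).

Definition Tcup1_21 (t : T2) (r : mX) : T2 :=
  tensor_lift (fun a b : mX => tens (Tcup1_11 a r) b + tens a (Tcup1_11 b r)) t.

Definition Tcirc : T2 -> T2 -> T2 := tensor_map2 Tcup1_11 Tcup1_11.

Lemma Tcup1_11_bilin : bilin Tcup1_11.
Proof.
split=> [r|q] c x y; apply: val_inj => /=.
  by rewrite mulrDl scalerAl.
by rewrite mulrDr scalerAr.
Qed.

Lemma Tcup1_21E a b c :
  Tcup1_21 (tens a b) c = tens (Tcup1_11 a c) b + tens a (Tcup1_11 b c).
Proof.
apply: tensor_liftE; split=> [b'|a'] d x y.
  by rewrite Tcup1_11_bilin.1 !tens_linl scalerDr addrACA.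
by rewrite Tcup1_11_bilin.1 !tens_linr scalerDr addrACA.
Qed.

Lemma Tcirc_tens a1 a2 b1 b2 :
  Tcirc (tens a1 a2) (tens b1 b2) = tens (Tcup1_11 a1 b1) (Tcup1_11 a2 b2).
Proof. exact: tensor_map2E Tcup1_11_bilin Tcup1_11_bilin _ _ _ _. Qed.

End TruncatedTensorAlgebra.

(* 2-dimensional Delta-sets.  For a triangle t with ordered vertices 0, 1, 2,
   front t, third t and back t are the edges 01, 02 and 12. *)
Record dset2 := DSet2 {
  vertex : Type;
  edge : Type;
  triangle : Type;
  src : edge -> vertex;
  tgt : edge -> vertex;
  front : triangle -> edge;
  back : triangle -> edge;
  third : triangle -> edge;
  front_back : forall t, tgt (front t) = src (back t);
  front_third : forall t, src (front t) = src (third t);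
  back_third : forall t, tgt (back t) = tgt (third t)
}.

Section Cochains.
Variables (R : comNzRingType) (D : dset2).

Definition C0 : lmodType R := vertex D -> R^o.
Definition C1 : lmodType R := edge D -> R^o.
Definition C2 : lmodType R := triangle D -> R^o.

Definition cochains : lmodType R := (C0 * C1 * C2)%type.

Definition cobound (u : cochains) : cochains :=
  (0 : C0,
   (fun e => u.1.1 (tgt e) - u.1.1 (src e)) : C1,
   (fun t => u.1.2 (back t) - u.1.2 (third t) + u.1.2 (front t)) : C2).

Lemma coboundK u : cobound (cobound u) = 0.
Proof.
congr (_, _, _); apply/funext => s /=; first exact: subrr.
have E (a b c : R) : a - b - (a - c) + (b - c) = 0 by ring.
by rewrite front_back front_third back_third; exact: E.
Qed.

Definition cup_11 (f g : C1) : C2 := fun t => f (front t) * g (back t).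

Definition cup (u v : cochains) : cochains :=
  ((fun x => u.1.1 x * v.1.1 x) : C0,
   (fun e => u.1.1 (src e) * v.1.2 e + u.1.2 e * v.1.1 (tgt e)) : C1,
   (fun t => u.1.1 (src (front t)) * v.2 t + cup_11 u.1.2 v.1.2 t
             + u.2 t * v.1.1 (tgt (back t))) : C2).

Definition cup1_11 (f g : C1) : C1 := fun e => f e * g e.

(* Steenrod's formula in degrees (2, 1); on products of 1-cochains it is the
   one given by the Hirsch identity, see hirsch. *)
Definition cup1_21 (w : C2) (h : C1) : C2 :=
  fun t => w t * (h (front t) + h (back t)).

Lemma hirsch f g h :
  cup1_21 (cup_11 f g) h = cup_11 f (cup1_11 g h) + cup_11 (cup1_11 f h) g.
Proof.
apply/funext => t; rewrite /cup1_21 /cup_11 /cup1_11 /= [RHS]/GRing.add /=.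
by rewrite mulrDr addrC mulrA mulrAC.
Qed.

Definition circ (v w : C2) : C2 := fun t => v t * w t.

End Cochains.

Section Psi.
Variables (R : comNzRingType) (X : choiceType) (A : binom_alg R X).
Variable mu : (X -> R) -> (X -> R) -> (X -> R).

Definition Delta2 : dset2 :=
  @DSet2 unit (X -> R) ((X -> R) * (X -> R))
    (fun=> tt) (fun=> tt) fst snd (fun s => mu s.1 s.2)
    (fun=> erefl) (fun=> erefl) (fun=> erefl).

Definition Cmu : lmodType R := cochains R Delta2.

Definition psi0 (r : R^o) : C0 R Delta2 := fun=> r.
Definition psi1 (q : mX A) : C1 R Delta2 := fun a => evalI a (val q).
Definition psi2 (t : T2 A) : C2 R Delta2 :=
  tensor_lift (fun q q' => (fun s => evalI s.1 (val q) * evalI s.2 (val q'))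
                           : C2 R Delta2) t.

Definition psi (u : Tle2 A) : Cmu := (psi0 u.1.1, psi1 u.1.2, psi2 u.2).

Lemma psi2_tens q q' a a' :
  psi2 (tens q q') (a, a') = evalI a (val q) * evalI a' (val q').
Proof.
rewrite /psi2 tensor_liftE //; split=> [v|u] c x y; apply/funext => s /=.
  by rewrite evalI_linear mulrDl -mulrA.
by rewrite evalI_linear mulrDr mulrCA.
Qed.

End Psi.

Arguments psi0 {R X} mu r.
Arguments psi1 {R X A} mu q.
Arguments psi2 {R X A} mu t.
Arguments psi {R X} A mu u.

(* Main.v *)
Require Import Defs.
From HB Require Import structures.
From mathcomp Require Import all_boot all_order all_algebra.
From mathcomp Require Import finmap boolp functions ring.
From mathcomp.multinomials Require Import monalg.

(** Once [psi] is known to be linear in each degree, compatibility with the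
    products only has to be checked on pure tensors; the content is injectivity.

    In degree 1 over Z, a polynomial vanishing at all integer points is zero
    because monomials are distinct characters of the multiplicative monoid Z^X,
    hence linearly independent.  Over F_p, expand q in one variable x by
    Newton's formula: q is the sum over n of binom(x, n) times the n-th
    difference at 0 of k |-> q(x := k).  The terms with n >= p lie in the ideal,
    the other coefficients only involve the specializations at k < p, and these
    vanish in Int(F_p^X) by induction on the set of variables.

    In degree 2, let sum_k u_k (x) v_k vanish at all pairs of points.  If the
    values c_k = u_k(a) are not all zero, then sum_k c_k v_k = 0.  Over Z and
    over a field, c is a multiple of a row of an invertible matrix, so a change
    of basis makes one of the v_k vanish, and the number of terms drops. *)

Set Implicit Arguments.
Unset Strict Implicit.
Unset Printing Implicit Defensive.

Import GRing.Theory Num.Theory.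
Local Open Scope ring_scope.
Local Open Scope quotient_scope.

Section FiniteDifferences.
Variable V : zmodType.
Implicit Type s : nat -> V.

Definition fdiff s : nat -> V := fun k => s k.+1 - s k.

Lemma newton_forward_difference s N k : (k < N)%N ->
  s k = \sum_(n < N) iter n fdiff s 0 *+ 'C(k, n).
Proof.
case: N => // N; elim: k s N => [|k IHk] s N kN.
  by rewrite big_ord_recl big1 ?addr0 // => n _; rewrite bin_small.
case: N kN => // N kN.
have -> : s k.+1 = s k + fdiff s k by rewrite addrC subrK.
rewrite (IHk s N.+1) 1?ltnW // (IHk (fdiff s) N) //.
rewrite [RHS]big_ord_recl [X in X + _]big_ord_recl !bin0 -addrA.
congr (_ + _); rewrite -big_split.
by apply: eq_bigr => n _; rewrite !lift0 iterSr binS mulrnDr.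
Qed.

Lemma iter_fdiff_eq0 s n k : (forall i, (i <= n + k)%N -> s i = 0) ->
  iter n fdiff s k = 0.
Proof.
elim: n k => [|n IHn] k s0 /=; first exact: s0.
have sk i : (i <= n + k.+1)%N -> s i = 0 by rewrite -addSnnS; exact: s0.
rewrite /fdiff !IHn ?subrr // => i ik; apply: sk.
by rewrite addnS ltnW.
Qed.

End FiniteDifferences.

Arguments fdiff {V} s.

Lemma raddf_iter_fdiff (V W : zmodType) (f : {additive V -> W}) s n k :
  f (iter n fdiff s k) = iter n fdiff (f \o s) k.
Proof. by elim: n k => //= n IHn k; rewrite /fdiff raddfB !IHn. Qed.

Section BinomialPolynomials.
Variable F : numFieldType.

Definition binom_poly n : {poly F} := n`!%:R^-1 *: \prod_(i < n) ('X - i%:R%:P).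

Lemma size_binom_poly_leq n : (size (binom_poly n) <= n.+1)%N.
Proof.
apply: leq_trans (size_scale_leq _ _) _.
by rewrite size_prod_XsubC /index_enum -enumT size_enum_ord.
Qed.

Lemma horner_binom_poly n y :
  (binom_poly n).[y] = n`!%:R^-1 * \prod_(i < n) (y - i%:R).
Proof.
by rewrite hornerZ horner_prod; under eq_bigr do rewrite hornerXsubC.
Qed.

Lemma binom_poly_nat n m : (binom_poly n).[m%:R] = 'C(m, n)%:R.
Proof.
rewrite horner_binom_poly; have [mn|nm] := ltnP m n.
  by rewrite bin_small // (bigD1 (Ordinal mn)) //= subrr mul0r mulr0.
have -> : \prod_(i < n) (m%:R - i%:R) = (m ^_ n)%:R :> F.
  rewrite ffact_prod natr_prod; apply: eq_bigr => i _.
  by rewrite natrB // ltnW // (leq_trans (ltn_ord i)).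
by rewrite -bin_ffact natrM mulrCA mulVf ?mulr1 // pnatr_eq0 -lt0n fact_gt0.
Qed.

Lemma newton_interpolation N (P : {poly F}) : (size P <= N)%N ->
  P = \sum_(n < N) iter n fdiff (fun k => P.[k%:R]) 0 *: binom_poly n.
Proof.
move=> sP; apply: subr0_eq.
apply: (@roots_geq_poly_eq0 _ _ [seq i%:R | i <- iota 0 N]).
- rewrite all_map; apply/allP => k; rewrite mem_iota /= add0n => kN.
  rewrite /root hornerD hornerN subr_eq0 horner_sum.
  rewrite (newton_forward_difference (fun k => P.[k%:R]) kN); apply/eqP.
  by apply: eq_bigr => n _; rewrite hornerZ binom_poly_nat mulr_natr.
- by rewrite map_inj_uniq ?iota_uniq //; exact: (mulrIn (oner_neq0 _)).
rewrite size_map size_iota (leq_trans (size_polyD _ _)) // size_polyN.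
rewrite geq_max sP; apply: leq_trans (size_sum _ _ _) _.
apply/bigmax_leqP => n _; apply: leq_trans (size_scale_leq _ _) _.
exact: leq_trans (size_binom_poly_leq n) (ltn_ord n).
Qed.

End BinomialPolynomials.

Section DedekindIndependence.
Variables (T : Type) (op : T -> T -> T) (F : idomainType) (K : eqType).
Variable chi : K -> T -> F.
Hypothesis chiM : forall k, {morph chi k : a b / op a b >-> a * b}.
Hypothesis chi_neq0 : forall k, exists a, chi k a != 0.
Hypothesis chi_inj : injective chi.

Lemma characters_free (s : seq K) (c : K -> F) : uniq s ->
  (forall a, \sum_(k <- s) c k * chi k a = 0) -> {in s, forall k, c k = 0}.
Proof.
elim: s c => // k0 s IHs c /= /andP[k0s us] c0.
have cs : {in s, forall k, c k = 0}.
  move=> k ks; have [b chib] : exists b, chi k b <> chi k0 b.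
    by apply/existsNP => /funext/chi_inj kk0; rewrite kk0 (negPf k0s) in ks.
  pose c' l := c l * (chi l b - chi k0 b).
  have /eqP : c' k = 0.
    apply: IHs ks => // a.
    transitivity (\sum_(l <- k0 :: s) c l * chi l (op a b)
                  - chi k0 b * \sum_(l <- k0 :: s) c l * chi l a).
      rewrite mulr_sumr -sumrB big_cons chiM mulrA mulrC subrr add0r.
      by apply: eq_bigr => l _; rewrite chiM /c'; ring.
    by rewrite !c0 mulr0 subrr.
  by rewrite mulf_eq0 subr_eq0 => /orP[|] /eqP.
move=> k; rewrite inE => /orP[/eqP->|]; last exact: cs.
have [a chia] := chi_neq0 k0; have := c0 a.
rewrite big_cons big_seq big1 ?addr0 => [/eqP|l /cs->]; last by rewrite mul0r.
by rewrite mulf_eq0 (negPf chia) orbF => /eqP.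
Qed.

End DedekindIndependence.

Section UpdatedFunctions.
Variables (X : eqType) (A : Type).
Implicit Type a : X -> A.

Lemma eta_with_id a x : [eta a with x |-> a x] = a :> (X -> A).
Proof. by apply/funext => y /=; case: eqP => [->|]. Qed.

Lemma comp_eta_with (B : Type) (f : A -> B) a x k :
  f \o [eta a with x |-> k] = [eta f \o a with x |-> f k].
Proof. by apply/funext => y /=; case: eqP. Qed.

End UpdatedFunctions.

Section PolynomialInduction.
Variable X : choiceType.

Lemma cmonom_ind (P : {cmonom X} -> Prop) :
  P mone -> (forall x m, P m -> P (mmul (ucm x) m)) -> forall m, P m.
Proof.
move=> P1 PM m; have [n] := ubnP (mdeg m); elim: n m => // n IHn m mn.
have [m0|[x xm]] := fset_0Vmem (finsupp m).
  suff -> : m = mone by [].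
  by apply/eqP/cmP => y; rewrite cm1; apply/eqP; rewrite cmE_eq0 m0 inE.
have mE : m = mmul (ucm x) (divcm m (ucm x)).
  apply/eqP/cmP => y; rewrite cmM divcmE cmU.
  case: eqP => [<-|_]; last by rewrite subn0.
  by rewrite subnKC // lt0n cmE_neq0.
by rewrite mE; apply/PM/IHn; rewrite mE mdegM mdegU in mn.
Qed.

Lemma malg_cmonom_ind (R : nzRingType) (P : {malg R[{cmonom X}]} -> Prop) :
  (forall c, P c%:MP) -> (forall x, P << ucm x >>) ->
  (forall q r, P q -> P r -> P (q + r)) ->
  (forall q r, P q -> P r -> P (q * r)) -> forall q, P q.
Proof.
move=> PC PX PD PM q; rewrite [q]monalgE.
elim/big_ind: _ => [|//|m _]; first by rewrite -malgC0E; exact: PC.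
elim/cmonom_ind: m (q@_m) => [|x m IHm] c; first exact: PC.
by rewrite -[c]mul1r -fgmulUU -malgM_def; exact: PM.
Qed.

End PolynomialInduction.

Section PolynomialEvaluation.
Variable X : choiceType.
Notation QX := {malg rat[{cmonom X}]}.
Implicit Types (a b : X -> rat) (q : QX).

Lemma peval_malgC a c : peval a c%:MP = c.
Proof. by rewrite /peval mmapC. Qed.

Lemma monom_eval_ucm a x : monom_eval a (ucm x) = a x.
Proof. by rewrite /monom_eval mdomU big_seq_fset1 cmUU. Qed.

Lemma peval_ucm a x : peval a << ucm x >> = a x.
Proof. by rewrite /peval mmapU mul1r /= monom_eval_ucm. Qed.

Definition pvars q : {fset X} := (\bigcup_(m <- msupp q) finsupp m)%fset.

Lemma eq_peval a b q : {in pvars q, a =1 b} -> peval a q = peval b q.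
Proof.
move=> ab; rewrite /peval !mmapE; apply: eq_big_seq => m mq; congr (_ * _).
apply: eq_big_seq => x xm; rewrite ab //.
by apply/bigfcupP; exists m; rewrite ?mq.
Qed.

Lemma monom_evalM a b (m : {cmonom X}) :
  monom_eval (a \* b) m = monom_eval a m * monom_eval b m.
Proof. by rewrite -big_split; apply: eq_bigr => x _; rewrite exprMn. Qed.

Lemma monom_eval_one_with x (c : rat) (m : {cmonom X}) :
  monom_eval [eta (fun=> 1) with x |-> c] m = c ^+ m x.
Proof.
elim/cmonom_ind: m => [|y m IHm]; first by rewrite mmorph1 cm1.
rewrite cmM cmU exprD -IHm mmorphM; congr (_ * _).
by rewrite [LHS]monom_eval_ucm /=; case: eqP.
Qed.

Lemma peval_int_eq0 q :
  (forall a : X -> int, peval (intr \o a) q = 0) -> q = 0.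
Proof.
move=> q0; apply/malgP => m; rewrite mcoeff0.
have [mq|] := boolP (m \in msupp q); last exact: mcoeff_outdom.
pose chi m (a : X -> int) := monom_eval (intr \o a) m : rat.
apply: (@characters_free _ (fun a b : X -> int => a \* b) _ _ chi) mq
  => [{}m a b|{}m|m1 m2||a].
- rewrite /chi -monom_evalM; congr monom_eval.
  by apply/funext => x; rewrite /= intrM.
- exists (fun=> 1); rewrite /chi /monom_eval big1 ?oner_neq0 // => x _.
  by rewrite expr1n.
- move=> chiE; apply/eqP/cmP => x.
  have chi_one_with n : chi n [eta (fun=> 1) with x |-> 2] = 2 ^+ n x.
    by rewrite /chi comp_eta_with monom_eval_one_with.
  by have := chi_one_with m1; rewrite chiE chi_one_with => /ieexprIn->.
- exact: fset_uniq.
- by rewrite -[RHS](q0 a) /peval mmapE.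
Qed.

Lemma peval_subst_ex x (c : rat) q :
  exists r : QX, forall a, peval a r = peval [eta a with x |-> c] q.
Proof.
elim/malg_cmonom_ind: q => [d|y|q r [q' qE] [r' rE]|q r [q' qE] [r' rE]].
- by exists d%:MP => a; rewrite !peval_malgC.
- exists (if y == x then c%:MP else << ucm y >>) => a.
  by rewrite peval_ucm /=; case: ifP; rewrite (peval_malgC, peval_ucm).
- by exists (q' + r') => a; rewrite !rmorphD /= qE rE.
- by exists (q' * r') => a; rewrite !rmorphM /= qE rE.
Qed.

Lemma peval_with_poly x q : exists N, forall a, exists2 P : {poly rat},
  (size P <= N)%N & forall y, P.[y] = peval [eta a with x |-> y] q.
Proof.
elim/malg_cmonom_ind: q => [c|y|q r [N qE] [M rE]|q r [N qE] [M rE]].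
- exists 1%N => a; exists c%:P => [|y]; first exact: size_polyC_leq1.
  by rewrite hornerC peval_malgC.
- exists 2%N => a; exists (if y == x then 'X else (a y)%:P).
    by case: ifP; rewrite ?size_polyX // (leq_trans (size_polyC_leq1 _)).
  by move=> z; rewrite peval_ucm /=; case: ifP; rewrite (hornerX, hornerC).
- exists (maxn N M) => a; have [P sP PE] := qE a; have [Q sQ QE] := rE a.
  exists (P + Q) => [|y]; last by rewrite hornerD PE QE -rmorphD.
  by rewrite (leq_trans (size_polyD _ _)) // geq_max !leq_max sP sQ orbT.
- exists (N + M)%N => a; have [P sP PE] := qE a; have [Q sQ QE] := rE a.
  exists (P * Q) => [|y]; last by rewrite hornerM PE QE -rmorphM.
  apply: leq_trans (size_polyMleq _ _) _.
  by rewrite (leq_trans (leq_pred _)) // leq_add.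
Qed.

End PolynomialEvaluation.

Section IntegerValuedPolynomials.
Variable X : choiceType.
Implicit Types (q r : IntZ X) (x : X).

Lemma evZ_inj q r : (forall a, evZ a q = evZ a r) -> q = r.
Proof.
move=> qr; apply/val_inj/subr0_eq/peval_int_eq0 => a.
by rewrite rmorphB /= -[intr \o a]/(fun x => (a x)%:~R) -!evZE qr subrr.
Qed.

Definition depends_on (S : {fset X}) q : Prop :=
  forall a b, {in S, a =1 b} -> evZ a q = evZ b q.

Lemma depends_on_ex q : exists S, depends_on S q.
Proof.
exists (pvars (val q)) => a b ab; apply: (@intr_inj rat); rewrite !evZE.
by apply: eq_peval => x xq; rewrite ab.
Qed.

Lemma evZ_subst_ex x (k : int) q :
  exists r, forall a, evZ a r = evZ [eta a with x |-> k] q.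
Proof.
have [r rE] := peval_subst_ex x k%:~R (val q).
have evE a : peval (intr \o a) r = (evZ [eta a with x |-> k] q)%:~R.
  by rewrite rE evZE -comp_eta_with.
have r_int : r \in @int_valued X.
  by apply/asboolP => a; rewrite -[fun x => _]/(intr \o a) evE intr_int.
by exists (MkIntZ r_int) => a; apply: (@intr_inj rat); rewrite evZE evE.
Qed.

Lemma evZ_binomZ a x n :
  (evZ a (binomZ x n))%:~R = (binom_poly rat n).[(a x)%:~R].
Proof. by rewrite evZE peval_binomX horner_binom_poly. Qed.

Lemma binomZ_newton_expansion x q (s : nat -> IntZ X) :
  (forall k a, evZ a (s k) = evZ [eta a with x |-> k%:Z] q) ->
  exists N, q = \sum_(n < N) binomZ x n * iter n fdiff s 0.
Proof.
move=> sE; have [N qN] := peval_with_poly x (val q); exists N.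
apply: evZ_inj => a; apply: (@intr_inj rat).
have [P sP PE] := qN (intr \o a).
have {}PE k : P.[k%:~R] = (evZ [eta a with x |-> k] q)%:~R.
  by rewrite PE evZE -comp_eta_with.
rewrite -{1}(eta_with_id a x) -PE (newton_interpolation sP).
rewrite horner_sum !rmorph_sum; apply: eq_bigr => n _.
rewrite hornerZ !rmorphM /= evZ_binomZ mulrC; congr (_ * _).
rewrite !raddf_iter_fdiff; congr (iter n _ _ 0); apply/funext => k /=.
by rewrite sE -PE.
Qed.

End IntegerValuedPolynomials.

Section ReductionModP.
Variables (X : choiceType) (p : primeT).
Implicit Types (x : X) (q : IntZ X).

HB.instance Definition _ (a : X -> 'F_p) :=
  GRing.isLinear.Build 'F_p (IntFp X p) ('F_p)^o _ (evFp a) (evFp_linear a).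

Lemma redFp_binomZ x n : (p <= n)%N -> redFp p (binomZ x n) = 0.
Proof.
move=> pn; rewrite /redFp.
suff -> : \pi_(IntZmod X p) (binomZ x n) = 0 by exact: IntFp_tens0l.
rewrite -(rmorph0 (\pi_(IntZmod X p))); apply/eqP.
rewrite -Quotient.idealrBE subr0; apply/asboolP.
by exists [:: (1, x, n)]; rewrite /= ?pn // big_seq1 mul1r.
Qed.

Lemma lift_Fp_eta_with (a : X -> 'F_p) x n : (n < p)%N ->
  lift_Fp [eta a with x |-> n%:R] = [eta lift_Fp a with x |-> n%:Z].
Proof.
move=> np; apply/funext => y /=; rewrite /lift_Fp /=; case: eqP => // _.
by rewrite val_Fp_nat ?prime_valP // modn_small.
Qed.

Lemma redFp_eq0 q : (forall a, evFp a (redFp p q) = 0) -> redFp p q = 0.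
Proof.
have [S] := depends_on_ex q; elim/finSet_rect: S q => S IHS q qS q0.
have [S0|[x xS]] := fset_0Vmem S.
  have qE : q = (evZ (fun=> 0) q)%:~R.
    apply: evZ_inj => a; rewrite rmorph_int intz.
    by apply: qS => y; rewrite S0 inE.
  have := q0 (fun=> 0); rewrite evFp_red /lift_Fp /= => q_const0.
  by rewrite qE rmorph_int -scaler_int q_const0 scale0r.
have [s sE] := choice (fun k : nat => evZ_subst_ex x k%:Z q).
have s0 k : (k < p)%N -> redFp p (s k) = 0.
  move=> kp; apply: (IHS (S `\ x)%fset); first exact: fproperD1.
    move=> a b ab; rewrite !sE; apply: qS => y yS /=; case: eqP => // /eqP yx.
    by apply: ab; rewrite !inE yx.
  by move=> a; rewrite evFp_red sE -lift_Fp_eta_with // -evFp_red.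
have [N ->] := binomZ_newton_expansion sE; rewrite rmorph_sum big1 // => n _.
rewrite rmorphM /=; have [pn|np] := leqP p n.
  by rewrite redFp_binomZ ?mul0r.
rewrite raddf_iter_fdiff iter_fdiff_eq0 ?mulr0 // => k.
by rewrite addn0 => kn; apply: s0; exact: leq_ltn_trans np.
Qed.

Lemma redFp_surj (t : IntFp X p) : exists q, t = redFp p q.
Proof.
elim/IntFp_ind: t => [b c t [q ->]|]; last by exists 0; rewrite raddf0.
elim/quotW: b => r; exists (r *+ nat_of_ord c + q).
rewrite raddfD /= -scale_redFp /GRing.scale /= IntFp_scaleE.
by rewrite -[X in _ = X + _]/(IntFp_mul _ _) IntFp_mulE mul1r mulr1.
Qed.

Lemma evFp_inj (t u : IntFp X p) : (forall a, evFp a t = evFp a u) -> t = u.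
Proof.
move=> tu; apply: subr0_eq; have [q tuE] := redFp_surj (t - u).
by rewrite tuE; apply: redFp_eq0 => a; rewrite -tuE raddfB /= tu subrr.
Qed.

End ReductionModP.

Section BilinearMaps.
Variable R : comNzRingType.

Lemma bilin_linear_comp (U V W W' : lmodType R) (f : U -> V -> W)
    (h : W -> W') :
  bilin f -> linear h -> bilin (fun u v => h (f u v)).
Proof. by move=> [fl fr] hl; split=> ? ? ? ?; rewrite (fl, fr) hl. Qed.

Lemma bilin_comp_linear (U U' V V' W : lmodType R) (f : U' -> V' -> W)
    (h : U -> U') (k : V -> V') :
  bilin f -> linear h -> linear k -> bilin (fun u v => f (h u) (k v)).
Proof.
by move=> [fl fr] hl kl; split=> ? ? ? ?; [rewrite hl fl|rewrite kl fr].
Qed.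

Lemma tensor_linear_ext (U V W : lmodType R) (F G : tensor U V -> W) :
  linear F -> linear G -> (forall u v, F (tens u v) = G (tens u v)) -> F =1 G.
Proof.
move=> Fl Gl FG; apply: tensor_ind => [c u v t FGt|].
  by rewrite Fl Gl FG FGt.
have := Gl (-1) 0 0; have := Fl (-1) 0 0.
by rewrite scaleN1r !addNr !scaleN1r !addNr => -> ->.
Qed.

Lemma tensor_bilin_ext (U U' V V' W : lmodType R)
    (F G : tensor U V -> tensor U' V' -> W) :
  bilin F -> bilin G ->
  (forall u v u' v', F (tens u v) (tens u' v') = G (tens u v) (tens u' v')) ->
  forall s t, F s t = G s t.
Proof.
move=> [Fl Fr] [Gl Gr] FG s t; move: s; apply: tensor_linear_ext => // u v.
by apply: tensor_linear_ext t => // u' v'; exact: FG.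
Qed.

End BilinearMaps.

Section MatrixCombinations.
Variables (R : comNzRingType) (V : lmodType R).

Definition mxcomb m n (A : 'M[R]_(m, n)) (v : 'I_n -> V) : 'I_m -> V :=
  fun i => \sum_j A i j *: v j.

Lemma mxcomb1 n (v : 'I_n -> V) : mxcomb 1%:M v =1 v.
Proof.
move=> i; rewrite /mxcomb (bigD1 i) //= mxE eqxx scale1r big1 ?addr0 // => j ji.
by rewrite mxE eq_sym (negPf ji) scale0r.
Qed.

Lemma mxcombM m n l (A : 'M_(m, n)) (B : 'M_(n, l)) v :
  mxcomb (A *m B) v =1 mxcomb A (mxcomb B v).
Proof.
move=> i; rewrite /mxcomb; under eq_bigr do rewrite mxE scaler_suml.
rewrite exchange_big; apply: eq_bigr => j _; rewrite scaler_sumr.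
by apply: eq_bigr => k _; rewrite scalerA.
Qed.

End MatrixCombinations.

Section TensorSums.
Variables (R : comNzRingType) (U V : lmodType R).

Lemma tens_suml (I : Type) (r : seq I) (P : pred I) (F : I -> U) (v : V) :
  tens (\sum_(i <- r | P i) F i) v = \sum_(i <- r | P i) tens (F i) v.
Proof.
exact: (big_morph (fun u => tens u v) (fun x y => tensDl x y v) (tens0l U v)).
Qed.

Lemma tens_sumr (I : Type) (r : seq I) (P : pred I) (u : U) (F : I -> V) :
  tens u (\sum_(i <- r | P i) F i) = \sum_(i <- r | P i) tens u (F i).
Proof. exact: (big_morph (fun v => tens u v) (tensDr u) (tens0r V u)). Qed.

Lemma tens_mxcomb m n (A : 'M[R]_(m, n)) (u : 'I_m -> U) (v : 'I_n -> V) :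
  \sum_i tens (u i) (mxcomb A v i) = \sum_j tens (mxcomb A^T u j) (v j).
Proof.
rewrite /mxcomb; under eq_bigr do rewrite tens_sumr; rewrite exchange_big.
apply: eq_bigr => j _; rewrite tens_suml; apply: eq_bigr => i _.
by rewrite mxE tensZl tensZr.
Qed.

Lemma tensor_sum_ex (t : tensor U V) :
  exists n (u : 'I_n -> U) (v : 'I_n -> V), t = \sum_i tens (u i) (v i).
Proof.
suff [s ->] : exists s : seq (U * V), t = \sum_(w <- s) tens w.1 w.2.
  exists (size s), (fun i => (tnth (in_tuple s) i).1).
  by exists (fun i => (tnth (in_tuple s) i).2); exact: big_tnth.
move: t; apply: tensor_ind => [c u v _ [s ->]|].
  by exists ((c *: u, v) :: s); rewrite big_cons tensZl.
by exists [::]; rewrite big_nil.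
Qed.

End TensorSums.

(* Kaplansky's Hermite rings: [c *m invmx P] is the row [(d, 0, ..., 0)]. *)
Definition hermite_ring (R : comUnitRingType) : Prop :=
  forall n (c : 'rV[R]_n.+1),
    exists2 P : 'M_n.+1, P \in unitmx & exists d, c = d *: row 0 P.

Lemma mulmx_delta_row (R : comNzRingType) n (L : 'M[R]_1) d (P : 'M_n.+1) :
  L *m (d *: delta_mx 0 0) *m P = (L 0 0 * d) *: row 0 P.
Proof.
by rewrite [L]mx11_scalar mul_scalar_mx !mxE mulr1n scalerA -scalemxAl -rowE.
Qed.

Lemma int_hermite_ring : hermite_ring int.
Proof.
move=> n c; have [L _ [P Pu [d _ ->]]] := int_Smith_normal_form c.
exists P => //; exists (L 0 0 * d`_0); rewrite -mulmx_delta_row.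
congr (_ *m _ *m _); apply/matrixP => i j.
by rewrite !mxE !ord1 /= mulr_natr eq_sym.
Qed.

Lemma field_hermite_ring (F : fieldType) : hermite_ring F.
Proof.
move=> n c; exists (row_ebase c); first exact: row_ebase_unit.
exists (col_ebase c 0 0 * (0 < \rank c)%N%:R); rewrite -mulmx_delta_row.
rewrite -{1}[c]mulmx_ebase; congr (_ *m _ *m _); apply/matrixP => i j.
by rewrite !mxE !ord1 /= -natrM mulnb andbC [in LHS]eq_sym.
Qed.

Section TensorOfFunctions.
Variables (R : comNzRingType) (U V : lmodType R) (I J : Type).
Variables (f : {linear U -> (I -> R^o)}) (g : {linear V -> (J -> R^o)}).

Definition fun_tensor : tensor U V -> (I * J -> R^o) :=
  tensor_lift (fun u v => (fun s => f u s.1 * g v s.2) : I * J -> R^o).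

Lemma fun_tensor_bilin :
  bilin (fun u v => (fun s => f u s.1 * g v s.2) : I * J -> R^o).
Proof.
split=> [v|u] c x y; apply/funext => s; rewrite linearP.
  by rewrite [LHS]mulrDl -mulrA.
by rewrite [LHS]mulrDr mulrCA.
Qed.

HB.instance Definition _ :=
  GRing.isLinear.Build R (tensor U V) (I * J -> R^o) _ fun_tensor
    (tensor_lift_linear fun_tensor_bilin).

Lemma fun_tensorE u v s : fun_tensor (tens u v) s = f u s.1 * g v s.2.
Proof. by rewrite /fun_tensor tensor_liftE //; exact: fun_tensor_bilin. Qed.

Lemma fun_tensor_sumE n (u : 'I_n -> U) (v : 'I_n -> V) s :
  fun_tensor (\sum_i tens (u i) (v i)) s = \sum_i f (u i) s.1 * g (v i) s.2.
Proof.
rewrite linear_sum fct_sumE.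
by apply: eq_bigr => i _; exact: fun_tensorE.
Qed.

End TensorOfFunctions.

Definition torsion_free (R : nzRingType) (V : lmodType R) : Prop :=
  forall (a : R) (v : V), a *: v = 0 -> a = 0 \/ v = 0.

Lemma inj_fun_torsion_free (R : idomainType) (V : lmodType R) (J : Type)
  (g : {linear V -> (J -> R^o)}) : injective g -> torsion_free V.
Proof.
move=> g_inj a v av; have [a0|a0] := eqVneq a 0; [by left|right].
apply: g_inj; rewrite linear0; apply/funext => j; apply/(mulfI a0).
by rewrite mulr0 -[RHS](congr1 (fun h => h j) (linear0 g)) -av linearZ.
Qed.

Section TensorOfFunctionsInjective.
Variables (R : idomainType) (U V : lmodType R) (I J : Type).
Hypothesis R_hermite : hermite_ring R.

Lemma tens_sum_shorten n (u : 'I_n.+1 -> U) (v : 'I_n.+1 -> V)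
    (c : 'I_n.+1 -> R) l :
  torsion_free V -> c l <> 0 -> \sum_k c k *: v k = 0 ->
  exists (u' : 'I_n -> U) (v' : 'I_n -> V),
    \sum_i tens (u i) (v i) = \sum_i tens (u' i) (v' i).
Proof.
move=> V_torsion_free cl cv.
have [P Pu [d /rowP cP]] := R_hermite (\row_k c k).
have {}cP k : c k = d * P 0 k by have := cP k; rewrite !mxE.
have Pv0 : mxcomb P v 0 = 0.
  have [|d0|//] := V_torsion_free d (mxcomb P v 0).
    by rewrite -cv scaler_sumr; apply: eq_bigr => k _; rewrite scalerA cP.
  by case: cl; rewrite cP d0 mul0r.
exists (fun i => mxcomb (invmx P)^T u (lift ord0 i)).
exists (fun i => mxcomb P v (lift ord0 i)).
transitivity (\sum_i tens (mxcomb (invmx P)^T u i) (mxcomb P v i)).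
  rewrite -tens_mxcomb; apply: eq_bigr => i _.
  by rewrite -mxcombM mulVmx // mxcomb1.
by rewrite big_ord_recl Pv0 tens0r add0r.
Qed.

Variables (f : {linear U -> (I -> R^o)}) (g : {linear V -> (J -> R^o)}).
Hypotheses (f_inj : injective f) (g_inj : injective g).

Lemma fun_tensor_inj : injective (fun_tensor f g).
Proof.
apply: raddf_inj => t; have [n [u [v ->]]] := tensor_sum_ex t.
elim: n u v => [|n IHn] u v fg0; first by rewrite big_ord0.
have [[i [l fl]]|f0] := pselect (exists i l, f (u l) i <> 0); last first.
  apply: big1 => l _; suff -> : u l = 0 by exact: tens0l.
  apply: f_inj; rewrite linear0; apply/funext => i.
  by apply: contrapT => fl; apply: f0; exists i, l.
have fv0 : \sum_k f (u k) i *: v k = 0.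
  apply: g_inj; rewrite linear0 linear_sum; apply/funext => j.
  rewrite fct_sumE -[RHS](congr1 (fun w => w (i, j)) fg0) [RHS]fun_tensor_sumE.
  by apply: eq_bigr => k _; rewrite linearZ.
have [u' [v' uv]] := tens_sum_shorten u (inj_fun_torsion_free g_inj) fl fv0.
by rewrite uv in fg0 *; exact: IHn.
Qed.

End TensorOfFunctionsInjective.

Section CochainProducts.
Variables (R : comNzRingType) (D : dset2).

Lemma circ_bilin : bilin (@circ R D).
Proof.
split=> [w|v] c x y; apply/funext => s.
  by rewrite /circ [LHS]mulrDl -mulrA.
by rewrite /circ [LHS]mulrDr mulrCA.
Qed.

Lemma cup1_21_linear (h : C1 R D) : linear ((@cup1_21 R D)^~ h).
Proof.
by move=> c x y; apply/funext => s; rewrite /cup1_21 [LHS]mulrDl -mulrA.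
Qed.

End CochainProducts.

Section TensorProducts.
Variables (R : comNzRingType) (X : choiceType) (A : binom_alg R X).

Lemma Tcup1_21_linear (r : mX A) : linear ((@Tcup1_21 R X A)^~ r).
Proof.
apply: tensor_lift_linear; split=> [b|a] c x y; rewrite (Tcup1_11_bilin A).1.
  by rewrite !tens_linl scalerDr addrACA.
by rewrite !tens_linr scalerDr addrACA.
Qed.

Lemma Tcirc_bilin : bilin (@Tcirc R X A).
Proof. exact: tensor_map2_bilin (Tcup1_11_bilin A) (Tcup1_11_bilin A). Qed.

End TensorProducts.

Section Psi.
Variables (R : comNzRingType) (X : choiceType) (A : binom_alg R X).
Variable mu : (X -> R) -> (X -> R) -> (X -> R).
Local Notation psi1 := (psi1 (A := A) mu).
Local Notation psi2 := (psi2 (A := A) mu).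

Lemma psi1_linear : linear psi1.
Proof. by move=> c q r; apply/funext => a; exact: evalI_linear. Qed.

HB.instance Definition _ :=
  GRing.isLinear.Build R (mX A) (C1 R (Delta2 mu)) _ psi1 psi1_linear.

Lemma psi2_fun_tensor : psi2 = fun_tensor psi1 psi1.
Proof. by []. Qed.

Lemma psi2_linear : linear psi2.
Proof. by rewrite psi2_fun_tensor; exact: linearP. Qed.

HB.instance Definition _ :=
  GRing.isLinear.Build R (T2 A) (C2 R (Delta2 mu)) _ psi2 psi2_linear.

Lemma psi_linear : linear (psi A mu).
Proof. by move=> c u v; rewrite /psi !linearP. Qed.

Lemma psi_cup (u v : Tle2 A) :
  psi A mu (Tcup u v) = cup (psi A mu u) (psi A mu v).
Proof.
congr (_, _, _) => /=.
  rewrite [psi1 _]linearD !linearZ; apply/funext => a /=.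
  by congr (_ + _); exact: mulrC.
rewrite [psi2 _]linearD [X in X + _]linearD.
rewrite [X in X + _ + _]linearZ [X in _ + X]linearZ.
apply/funext => -[a a']; congr (_ + _ + _); first exact: psi2_tens.
exact: mulrC.
Qed.

Lemma psi1_cup1 (q r : mX A) : psi1 (Tcup1_11 q r) = cup1_11 (psi1 q) (psi1 r).
Proof. by apply/funext => a; exact: (evalIM a (val q) (val r)). Qed.

Lemma psi2_cup1 (t : T2 A) (r : mX A) :
  psi2 (Tcup1_21 t r) = cup1_21 (psi2 t) (psi1 r).
Proof.
move: t; apply: tensor_linear_ext => [c s t|c s t|q q'].
- by rewrite Tcup1_21_linear linearP.
- by rewrite linearP cup1_21_linear.
rewrite Tcup1_21E linearD; apply/funext => -[a a'].
rewrite [LHS]/GRing.add /= /cup1_21 !psi2_tens /= !evalIM.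
by rewrite mulrDr mulrA mulrAC.
Qed.

Lemma psi2_circ (s t : T2 A) : psi2 (Tcirc s t) = circ (psi2 s) (psi2 t).
Proof.
move: s t; apply: tensor_bilin_ext => [||q q' r r'].
- exact: bilin_linear_comp (Tcirc_bilin A) psi2_linear.
- exact: bilin_comp_linear (circ_bilin _ _) psi2_linear psi2_linear.
apply/funext => -[a a'].
by rewrite Tcirc_tens /circ !psi2_tens /= !evalIM mulrACA.
Qed.

End Psi.

Lemma psi_inj (R : idomainType) (X : choiceType) (A : binom_alg R X)
    (mu : (X -> R) -> (X -> R) -> (X -> R)) :
  hermite_ring R ->
  (forall q r : A, (forall a, evalI a q = evalI a r) -> q = r) ->
  injective (psi A mu).
Proof.
move=> R_hermite evalI_inj [[r q] t] [[r' q'] t'] [rr' qq' tt'].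
have psi1_inj : injective (psi1 (A := A) mu).
  by move=> f g fg; apply/val_inj/evalI_inj => a; exact: (congr1 (@^~ a) fg).
congr (_, _, _); first exact: (congr1 (@^~ tt) rr').
  exact: psi1_inj.
rewrite psi2_fun_tensor in tt'.
exact: (fun_tensor_inj R_hermite psi1_inj psi1_inj) tt'.
Qed.

Theorem lemma7p1 (k : coef) (X : choiceType)
    (mu : (X -> coef_ring k) -> (X -> coef_ring k) -> (X -> coef_ring k)) :
  let A := IntR k X in
  [/\ linear (psi A mu),
      injective (psi A mu),
      (forall u v : Tle2 A,
         psi A mu (Tcup u v) = cup (psi A mu u) (psi A mu v)),
      (forall q r : mX A,
         psi1 mu (Tcup1_11 q r) = cup1_11 (psi1 mu q) (psi1 mu r)) /\
      (forall (t : T2 A) (r : mX A),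
         psi2 mu (Tcup1_21 t r) = cup1_21 (psi2 mu t) (psi1 mu r))
    & (forall s t : T2 A,
         psi2 mu (Tcirc s t) = circ (psi2 mu s) (psi2 mu t))].
Proof.
split.
- exact: psi_linear.
- case: k mu => [|p] mu; apply: psi_inj.
  + exact: int_hermite_ring.
  + exact: evZ_inj.
  + exact: field_hermite_ring.
  + exact: evFp_inj.
- exact: psi_cup.
- by split; [exact: psi1_cup1|exact: psi2_cup1].
- exact: psi2_circ.
Qed.
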